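(* Let $\dot A$ be a densely defined closed symmetric operator with deficiency indices $(1,1)$ in a Hilbert space $\mathcal H$, with $(+)$-normalized deficiency vectors $g_\pm\in\operatorname{Ker}(\dot A^*\mp iI)$. Let $\Theta$ be an L-system with symmetric operator $\dot A$, main operator $T\neq T^*$ (a maximal dissipative extension of $\dot A$) and quasi-kernel $\hat A$ of $\operatorname{Re}\mathbb A$, such that $g_+-\kappa g_-\in\operatorname{Dom}(T)$ for some $0\le\kappa<1$ and $g_+-g_-\in\operatorname{Dom}(\hat A)$. Assume that $\Theta$ has finite c-Entropy $\mathcal S$. Then for every real $Q\neq0$ the dissipation coefficient $\mathcal D(Q)$ of the perturbed L-system $\Theta(Q)$ is $$\mathcal D(Q)=\frac{4(Y+Z)(X+aZ)}{\left(X+Y+Z(a+1)\right)^2},$$ where $$a=\tanh\left(\tfrac{\mathcal S}{2}\right),\quad b=Q^2+a^2-1,\quad X=\left(b-2Q^2-\sqrt{b^2+4Q^2}\right)^2,\quad Y=a\left(b-\sqrt{b^2+4Q^2}\right)^2,\quad Z=4aQ^2.$$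
   Context: Rigged space: for a densely defined closed symmetric operator $\dot A$ in $\mathcal H$, let $\mathcal H_+=\operatorname{Dom}(\dot A^* )$ with inner product $(f,g)_+=(f,g)+(\dot A^*f,\dot A^*g)$, and let $\mathcal H_-$ be its dual, giving $\mathcal H_+\subset\mathcal H\subset\mathcal H_-$. $[\mathcal H_1,\mathcal H_2]$ denotes bounded linear operators from $\mathcal H_1$ to $\mathcal H_2$. If $\mathbb A\in[\mathcal H_+,\mathcal H_-]$ then $\mathbb A^*\in[\mathcal H_+,\mathcal H_-]$; put $\operatorname{Re}\mathbb A=\frac12(\mathbb A+\mathbb A^* )$, $\operatorname{Im}\mathbb A=\frac1{2i}(\mathbb A-\mathbb A^* )$. ''$(+)$-normalized'' means $\|g_\pm\|_+=1$ (note $\|g_\pm\|_+^2=2\|g_\pm\|^2$); ''$(\cdot)$-normalized'' means unit norm in $\mathcal H$. An operator $T$ is dissipative if $\operatorname{Im}(Tf,f)\ge 0$ for all $f\in\operatorname{Dom}(T)$. $( * )$-extension: for $T$ with $\dot A\subset T\subset\dot A^*$, an operator $\mathbb A\in[\mathcal H_+,\mathcal H_-]$ is a $( * )$-extension of $T$ if $\dot A\subset T\subset\mathbb A$, $\dot A\subset T^*\subset\mathbb A^*$ and the quasi-kernel $\hat A$ of $\operatorname{Re}\mathbb A$, i.e. the restriction of $\operatorname{Re}\mathbb A$ to $\{f\in\mathcal H_+:(\operatorname{Re}\mathbb A)f\in\mathcal H\}$, is a self-adjoint extension of $\dot A$ in $\mathcal H$. L-system: given $\dot A$ with deficiency indices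 $(1,1)$ and a dissipative $T$ with $\dot A\subset T\subset\dot A^*$, an L-system $\Theta$ with symmetric operator $\dot A$ and main operator $T$ consists of the rigged space above, a $( * )$-extension $\mathbb A$ of $T$ (the state-space operator), and $K\in[\mathbb C,\mathcal H_-]$ with $K^*\in[\mathcal H_+,\mathbb C]$ and $\operatorname{Im}\mathbb A=KK^*$. Its transfer function is $W_\Theta(z)=I-2iK^*(\mathbb A-zI)^{-1}K$, $z\in\rho(T)$, and its impedance function is $V_\Theta(z)=K^*(\operatorname{Re}\mathbb A-zI)^{-1}K$; for $z\in\rho(T)$, $\operatorname{Im}z\ne0$, they are related by $V_\Theta(z)=i[W_\Theta(z)+I]^{-1}[W_\Theta(z)-I]$ and $W_\Theta(z)=(I+iV_\Theta(z))^{-1}(I-iV_\Theta(z))$. Von Neumann parameter: $\kappa$ is the von Neumann parameter of $T$ with respect to a deficiency basis $g_\pm$ (vectors of equal norm in $\operatorname{Ker}(\dot A^*\mp iI)$) if $g_+-\kappa g_-\in\operatorname{Dom}(T)$. Perturbation: for $Q\in\mathbb R\setminus\{0\}$, the perturbed L-system $\Theta(Q)$ (the perturbation of $\Theta$) is an L-system with the same symmetric operator $\dot A$ as $\Theta$ whose impedance function satisfies the impedance shift formula $V_{\Theta(Q)}(z)=Q+V_\Theta(z)$. c-Entropy: the c-Entropy of an L-system $\Theta$ is $\mathcal S=-\ln|W_\Theta(-i)|$ (equal to $+\infty$ when $W_\Theta(-i)=0$). Dissipation coefficient: let $T$ be the main operator of an L-system and let $g'_\pm\in\operatorname{Ker}(\dot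 A^*\mp iI)$ be a $(\cdot)$-normalized deficiency basis with respect to which the von Neumann parameter $\kappa$ of $T$ satisfies $0\le\kappa\le1$. With $\tilde y=g'_+-\kappa g'_-$, the dissipation coefficient of the L-system is $\mathcal D=\operatorname{Im}(T\tilde y,\tilde y)$. *)

(* Defs.v *)
From HB Require Import structures.
From mathcomp Require Import all_boot all_order all_algebra sesquilinear.
From mathcomp Require Import complex.
From mathcomp Require Import all_classical all_reals all_analysis.
Set Implicit Arguments.
Unset Strict Implicit.
Unset Printing Implicit Defensive.
Import Order.TTheory GRing.Theory Num.Theory Num.Def.
Import numFieldNormedType.Exports.
Local Open Scope classical_set_scope.
Local Open Scope complex_scope.
Local Open Scope ring_scope.

Definition tanh {R : realType} (x : R) : R :=
  (expR x - expR (- x)) / (expR x + expR (- x)).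

Definition cabs {R : realType} (w : R[i]) : R := complex.Re `|w|.

(* A complex Hilbert space is a complete normed module over R[i] whose norm is
   the one of an inner product; {dot H for conjC} is linear in the first
   argument and conjugate-linear in the second. *)
Definition hilbert_norm {R : realType} {H : completeNormedModType R[i]}
    (dot : {dot H for conjC}) : Prop :=
  forall x : H, `|x| ^+ 2 = dot x x.

Section UnboundedOperators.
Context {R : realType} {H : completeNormedModType R[i]}.
Variable dot : {dot H for conjC}.

(* Only the values of [act] on [dom] are meaningful; inclusion and equality of
   operators are therefore [op_sub] and [op_eq]. *)
Record operator := Operator { dom : set H; act :> H -> H }.

Definition linear_operator (T : operator) : Prop :=
  dom T 0 /\
  forall (c : R[i]) f g, dom T f -> dom T g ->
    dom T (c *: f + g) /\ T (c *: f + g) = c *: T f + T g.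

Definition op_sub (S T : operator) : Prop :=
  forall f, dom S f -> dom T f /\ S f = T f.

Definition op_eq (S T : operator) : Prop := op_sub S T /\ op_sub T S.

Definition densely_defined (T : operator) : Prop := dense (dom T).

Definition closed_operator (T : operator) : Prop :=
  closed [set p : H * H | dom T p.1 /\ p.2 = T p.1].

Definition symmetric_operator (T : operator) : Prop :=
  forall f g, dom T f -> dom T g -> dot (T f) g = dot f (T g).

Definition adjoint_graph (T : operator) (g h : H) : Prop :=
  forall f, dom T f -> dot (T f) g = dot f h.

(* [h] is unique as soon as [T] is densely defined *)
Definition adjoint (T : operator) : operator :=
  Operator [set g | exists h, adjoint_graph T g h]
           (fun g => xget 0 [set h | adjoint_graph T g h]).

Definition selfadjoint (T : operator) : Prop := op_eq T (adjoint T).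

Definition dissipative (T : operator) : Prop :=
  forall f, dom T f -> 0 <= complex.Im (dot (T f) f).

Definition maximal_dissipative (T : operator) : Prop :=
  dissipative T /\
  forall T', linear_operator T' -> dissipative T' -> op_sub T T' -> op_sub T' T.

(* Ker (T - z I) *)
Definition ker_sub (T : operator) (z : R[i]) : set H :=
  [set g | dom T g /\ T g = z *: g].

Definition has_dim (V : set H) (n : nat) : Prop :=
  exists e : 'I_n -> H,
    [/\ forall i, V (e i),
        forall c : 'I_n -> R[i], \sum_(i < n) c i *: e i = 0 -> forall i, c i = 0
      & forall x, V x -> exists c : 'I_n -> R[i], x = \sum_(i < n) c i *: e i].

Definition deficiency_indices (A : operator) (m n : nat) : Prop :=
  has_dim (ker_sub (adjoint A) 'i) m /\ has_dim (ker_sub (adjoint A) (- 'i)) n.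

Definition deficiency_basis (A : operator) (gp gm : H) : Prop :=
  [/\ ker_sub (adjoint A) 'i gp, ker_sub (adjoint A) (- 'i) gm,
      gp != 0 & `|gp| = `|gm| ].

Definition von_neumann_parameter (A T : operator) (gp gm : H) (k : R[i]) : Prop :=
  deficiency_basis A gp gm /\ dom T (gp - k *: gm).

End UnboundedOperators.

Section RiggedSpace.
Context {R : realType} {H : completeNormedModType R[i]}.
Variables (dot : {dot H for conjC}) (A : @operator R H).

Definition Hplus : set H := dom (adjoint dot A).

Definition dot_plus (f g : H) : R[i] :=
  dot f g + dot (adjoint dot A f) (adjoint dot A g).

Definition norm_plus (f : H) : R := Num.sqrt (complex.Re (dot_plus f f)).

(* Elements phi of H_- are the bounded conjugate-linear functionals on H_+,
   [phi g] being the pairing (phi, g); functions on [H] represent them up to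
   [eq_minus].  The inclusion of H in H_- sends h to g |-> (h, g). *)
Definition eq_minus (phi psi : H -> R[i]) : Prop :=
  forall g, Hplus g -> phi g = psi g.

Definition Hminus : set (H -> R[i]) :=
  [set phi | (forall (c : R[i]) f g, Hplus f -> Hplus g ->
                phi (c *: f + g) = conjC c * phi f + phi g) /\
             (exists M : R, forall g, Hplus g -> cabs (phi g) <= M * norm_plus g)].

Definition norm_minus (phi : H -> R[i]) : R :=
  sup [set cabs (phi g) | g in [set g | Hplus g /\ norm_plus g <= 1]].

Definition to_minus (h : H) : H -> R[i] := fun g => dot h g.

(* [H_+, H_-] *)
Definition bounded_pm (B : H -> H -> R[i]) : Prop :=
  [/\ forall f, Hplus f -> Hminus (B f),
      forall (c : R[i]) f g, Hplus f -> Hplus g ->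
        eq_minus (B (c *: f + g)) (fun h => c * B f h + B g h)
    & exists M : R, forall f, Hplus f -> norm_minus (B f) <= M * norm_plus f].

(* (B f, g) = (f, B^* g), where (f, psi) is the conjugate of (psi, f) *)
Definition adj_pm (B : H -> H -> R[i]) : H -> H -> R[i] :=
  fun f g => conjC (B g f).

Definition re_pm (B : H -> H -> R[i]) : H -> H -> R[i] :=
  fun f g => 2^-1 * (B f g + adj_pm B f g).

Definition im_pm (B : H -> H -> R[i]) : H -> H -> R[i] :=
  fun f g => (2 * 'i)^-1 * (B f g - adj_pm B f g).

Definition op_sub_pm (T : operator) (B : H -> H -> R[i]) : Prop :=
  forall f, dom T f -> Hplus f /\ eq_minus (B f) (to_minus (T f)).

(* restriction of B to {f in H_+ | B f in H} *)
Definition quasi_kernel (B : H -> H -> R[i]) : operator :=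
  Operator [set f | Hplus f /\ exists h, eq_minus (B f) (to_minus h)]
           (fun f => xget 0 [set h | eq_minus (B f) (to_minus h)]).

Definition star_extension (T : operator) (B : H -> H -> R[i]) : Prop :=
  [/\ bounded_pm B,
      op_sub A T /\ op_sub_pm T B,
      op_sub A (adjoint dot T) /\ op_sub_pm (adjoint dot T) (adj_pm B)
    & op_sub A (quasi_kernel (re_pm B)) /\ selfadjoint dot (quasi_kernel (re_pm B))].

(* [C, H_-] *)
Definition bounded_cm (K : R[i] -> H -> R[i]) : Prop :=
  [/\ forall c, Hminus (K c),
      forall a c d : R[i], eq_minus (K (a * c + d)) (fun g => a * K c g + K d g)
    & exists M : R, forall c, norm_minus (K c) <= M * cabs c].

(* (K c, g) = c * conjC (K^* g) for all c *)
Definition adj_cm (K : R[i] -> H -> R[i]) : H -> R[i] :=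
  fun g => conjC (K 1 g).

(* (B - z I)^-1 phi *)
Definition resolvent_pm (B : H -> H -> R[i]) (z : R[i]) (phi : H -> R[i]) : H :=
  xget 0 [set f | Hplus f /\
                  eq_minus (fun g => B f g - z * to_minus f g) phi].

Record Lsystem := {
  main : operator;
  state : H -> H -> R[i];
  channel : R[i] -> H -> R[i];
  main_linear : linear_operator main;
  main_dissipative : dissipative dot main;
  main_lower : op_sub A main;
  main_upper : op_sub main (adjoint dot A);
  state_star_extension : star_extension main state;
  channel_bounded : bounded_cm channel;
  state_im : forall f, Hplus f ->
    eq_minus (im_pm state f) (channel (adj_cm channel f)) }.

(* W and V act on the one-dimensional space C and are identified with the
   scalars by which they multiply, namely their values at 1. *)
Definition transfer (Th : Lsystem) (z : R[i]) : R[i] :=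
  1 - 2 * 'i * adj_cm (channel Th) (resolvent_pm (state Th) z (channel Th 1)).

Definition impedance (Th : Lsystem) (z : R[i]) : R[i] :=
  adj_cm (channel Th) (resolvent_pm (re_pm (state Th)) z (channel Th 1)).

Definition c_entropy (Th : Lsystem) : \bar R :=
  if transfer Th (- 'i) == 0 then +oo%E
  else (- ln (cabs (transfer Th (- 'i))))%:E.

Definition perturbed (Th : Lsystem) (Q : R) (ThQ : Lsystem) : Prop :=
  forall z : R[i], complex.Im z != 0 -> impedance ThQ z = Q%:C + impedance Th z.

Definition dissipation_coefficient (Th : Lsystem) (D : R) : Prop :=
  exists (gp gm : H) (k : R),
    [/\ `|gp| = 1 /\ `|gm| = 1,
        von_neumann_parameter dot A (main Th) gp gm k%:C,
        0 <= k <= 1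
      & let y := gp - k%:C *: gm in D = complex.Im (dot (main Th y) y)].

End RiggedSpace.

(* Main.v *)
Require Import Defs.
From HB Require Import structures.
From mathcomp Require Import all_boot all_order all_algebra sesquilinear.
From mathcomp Require Import complex.
From mathcomp Require Import all_classical all_reals all_analysis.
From mathcomp Require Import ring lra.
Import Order.TTheory GRing.Theory Num.Theory Num.Def.
Import numFieldNormedType.Exports.
Local Open Scope classical_set_scope.
Local Open Scope complex_scope.
Local Open Scope ring_scope.

(* By von Neumann's formula every f in Dom(A^* ) is f0 + x g+ + y g- with f0 in
   Dom(A), and the boundary form (A^* f, f') - (f, A^* f') only depends on the
   coordinates (x, y), (x', y').  If the quasi-kernel of Re AA contains g+ - g-,
   hermitian symmetry forces
     (Re AA f, f') = (A^* f, f') + (x + y)/2 * omega_r(x', y')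
   for one real number r, and K is c * omega_r for some complex c.  Then
   V(i) = |c|^2 (2i + r), while T is cut out of A^* by a linear equation on
   (x, y) whose coefficients depend on r and |c|^2 only.  For Theta this gives
   r = 0, 2|c|^2 = (1 - k)/(1 + k) and W(-i) = k, hence V(i) = i tanh(S/2).
   After rotating g- so that the normalization holds for Theta(Q), the value
   V(i) = Q + ia determines its r and |c|^2, hence its main operator, whose von
   Neumann parameter kappa = (1 - a + iQ)/(1 + a + iQ) gives
   D(Q) = 1 - |kappa|^2 = 4a/((1 + a)^2 + Q^2). *)

(** * Conjugation and phases in [R[i]] *)

Section Complex.
Set Implicit Arguments.
Unset Strict Implicit.
Context {R : realType}.

Lemma conjC_half (z : R[i]) : (z / 2)^* = z^* / 2.
Proof. by rewrite rmorphM fmorphV (rmorph_nat conjC). Qed.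

Lemma conjC_realc (r : R) : (r%:C)^* = r%:C.
Proof. by apply/CrealP/complex_realP; exists r. Qed.

Lemma complexDi (x y : R) : x%:C + 'i * y%:C = x +i* y.
Proof. by rewrite -complexiE; simpc. Qed.

Lemma norm_direction_conj (z : R[i]) : z != 0 -> z / `|z| * (z / `|z|)^* = 1.
Proof.
by move=> z0; rewrite -normCK normrM normfV normr_id divff ?expr1n // normr_eq0.
Qed.

End Complex.

(** * Hilbert space geometry: Cauchy-Schwarz and orthogonal projection *)

Section Dot.
Set Implicit Arguments.
Unset Strict Implicit.
Context {R : realType} {H : completeNormedModType R[i]}.
Variable dot : {dot H for conjC}.

Lemma dotDl x y z : dot (x + y) z = dot x z + dot y z.
Proof. exact: linearDl. Qed.
Lemma dotZl (c : R[i]) x z : dot (c *: x) z = c * dot x z.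
Proof. exact: linearZl_LR. Qed.
Lemma dotDr x y z : dot z (x + y) = dot z x + dot z y.
Proof. exact: linearD. Qed.
Lemma dotZr (c : R[i]) x z : dot z (c *: x) = c^* * dot z x.
Proof. exact: linearZ. Qed.
Lemma dotC x y : (dot x y)^* = dot y x.
Proof. by rewrite [RHS]hermC mul1r. Qed.
Lemma dotNl x z : dot (- x) z = - dot x z.
Proof. by rewrite -scaleN1r dotZl mulN1r. Qed.
Lemma dotNr x z : dot z (- x) = - dot z x.
Proof. by rewrite -scaleN1r dotZr rmorphN1 mulN1r. Qed.
Lemma dot0l z : dot 0 z = 0.
Proof. by rewrite -(scale0r 0) dotZl mul0r. Qed.
Lemma dot0r z : dot z 0 = 0.
Proof. by rewrite -(scale0r 0) dotZr rmorph0 mul0r. Qed.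

Hypothesis hdot : hilbert_norm dot.

(** Pythagoras for the part of [y] orthogonal to [x], cleared of denominators. It yields
    Cauchy-Schwarz and, for projections, bounds an inner product by a decrease of distance. *)
Lemma dot_residual x y : x != 0 ->
  `|y - (dot y x / dot x x) *: x| ^+ 2 * `|x| ^+ 2 =
  `|y| ^+ 2 * `|x| ^+ 2 - `|dot x y| ^+ 2.
Proof.
move=> x0; have xx0 : dot x x != 0 by rewrite -hdot expf_neq0 // normr_eq0.
rewrite !hdot !(dotDl, dotDr, dotNl, dotNr, dotZl, dotZr) rmorphM /= fmorphV /=.
rewrite !dotC normCK dotC; field; exact: xx0.
Qed.

Lemma CauchySchwarz_hilbert x y : `|dot x y| <= `|x| * `|y|.
Proof.
have [->|x0] := eqVneq x 0; first by rewrite dot0l !normr0 mul0r.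
rewrite -(@ler_pXn2r _ 2) ?nnegrE ?mulr_ge0 // exprMn -subr_ge0 [_ * `|y| ^+ 2]mulrC.
by rewrite -dot_residual // mulr_ge0 // exprn_ge0.
Qed.

(** Positive elements of [R[i]] are real, so the Archimedean property of [R] applies to their real
    parts. *)
Lemma near_infty_harmonic (e : R[i]) : 0 < e ->
  \forall n \near \oo, n.+1%:R^-1 < e.
Proof.
move=> e0; have e10 : 0 < complex.Re e by rewrite -ltcR RRe_real // gtr0_real.
near=> n.
have : n.+1%:R^-1 < complex.Re e.
  by near: n; exact: near_infty_natSinv_lt (PosNum e10).
by rewrite -ltcR fmorphV !rmorph_nat /= RRe_real // gtr0_real.
Unshelve. all: by end_near. Qed.

Lemma cauchy_harmonic (u : nat -> H) :
  (forall m n, `|u m - u n| <= m.+1%:R^-1 + n.+1%:R^-1) ->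
  exists l : H, u n @[n --> \oo] --> l.
Proof.
move=> hu; apply/cvg_ex; apply: cauchy_cvg; apply: cauchy_exP => e e0.
have [N _ hN] := near_infty_harmonic (divr_gt0 e0 (ltr0n _ 2)).
exists (u N); exists N => // n /= nN; rewrite -ball_normE /=.
apply: le_lt_trans (hu _ _) _; rewrite [e]splitr.
by apply: ltrD; apply: hN => //=.
Qed.

(** The projection is the limit of a sequence in [M] whose distance to [h] tends to the infimum.
    Squared distances are taken in [R], where infima exist. *)
Lemma orthogonal_projection (M : set H) (h : H) :
  M 0 -> (forall c x y, M x -> M y -> M (c *: x + y)) -> closed M ->
  exists2 m, M m & forall x, M x -> dot x (h - m) = 0.
Proof.
move=> M0 ML Mc.
pose q (x : H) := complex.Re (`|x| ^+ 2).
have qE x : (q x)%:C = `|x| ^+ 2.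
  by rewrite /q RRe_real // realX // normr_real.
pose E := [set q (h - m) | m in M].
have E_inf : has_inf E.
  split; first by exists (q (h - 0)); exists 0.
  by exists 0 => _ [m _ <-]; rewrite -lecR qE exprn_ge0.
have inf_le m : M m -> inf E <= q (h - m).
  by move=> Mm; apply: ge_inf; [case: E_inf|exists m].
(* The tolerance is a square so that the bound in [dotu], obtained by a square root, is of order
   [n.+1%:R^-1]. *)
have near_min n : {m | M m /\ q (h - m) <= inf E + n.+1%:R^-1 ^+ 2}.
  apply: cid; have e0 : 0 < n.+1%:R^-1 ^+ 2 :> R by rewrite exprn_gt0 // invr_gt0.
  have [_ [m Mm <-] /ltW ?] := inf_adherent e0 E_inf.
  by exists m.
pose u n := sval (near_min n).
have Mu n : M (u n) by have [] := svalP (near_min n).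
have qu n : q (h - u n) <= inf E + n.+1%:R^-1 ^+ 2 by have [] := svalP (near_min n).
(* Comparing h - u n with its best correction along x bounds their inner
   product; applied to x = u m - u n this already makes u a Cauchy sequence. *)
have dotu n x : M x -> `|dot x (h - u n)| <= `|x| * n.+1%:R^-1.
  move=> Mx; have [->|x0] := eqVneq x 0; first by rewrite dot0l !normr0 mul0r.
  set t := dot (h - u n) x / dot x x.
  have le1 : `|h - u n| ^+ 2 <= `|h - u n - t *: x| ^+ 2 + n.+1%:R^-1 ^+ 2.
    have -> : n.+1%:R^-1 ^+ 2 = (n.+1%:R^-1 ^+ 2)%:C :> R[i].
      by rewrite rmorphXn /= fmorphV rmorph_nat.
    rewrite -!qE -rmorphD lecR; apply: le_trans (qu n) _; rewrite lerD2r.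
    have -> : h - u n - t *: x = h - (t *: x + u n) by rewrite opprD addrA addrAC.
    exact/inf_le/ML.
  rewrite -(@ler_pXn2r _ 2) ?nnegrE ?mulr_ge0 ?invr_ge0 // exprMn.
  have /eqP := dot_residual (h - u n) x0; rewrite -/t eq_sym subr_eq => /eqP res.
  have := ler_wpM2r (exprn_ge0 2 (normr_ge0 x)) le1.
  by rewrite mulrDl res addrC [leRHS]addrC [in leRHS]mulrC lerD2r.
have [l ul] : exists l : H, u n @[n --> \oo] --> l.
  apply: cauchy_harmonic => m n.
  have [->|umn] := eqVneq (u m) (u n).
    by rewrite subrr normr0 addr_ge0 // invr_ge0.
  rewrite -(@ler_pM2l _ `|u m - u n|) ?normr_gt0 ?subr_eq0 // mulrDr.
  have Mx : M (u m - u n) by rewrite addrC -scaleN1r; exact: ML.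
  have eqx : u m - u n = (h - u n) - (h - u m).
    by rewrite opprB [RHS]addrC addrA subrK.
  rewrite -expr2 -(ger0_norm (exprn_ge0 2 (normr_ge0 _))) hdot {2}eqx dotDr dotNr.
  rewrite [leRHS]addrC; apply: le_trans (ler_normB _ _) _.
  by apply: lerD; exact: dotu.
have Ml : M l by apply: closed_cvg ul => //; exact: nearW.
exists l => // x Mx; apply/eqP; rewrite -normr_le0.
apply/ler_addgt0Pr => e e0; rewrite add0r.
(* Adding 1 keeps the denominator nonzero when [x = 0]. *)
have x1 : 0 < `|x| + 1 by rewrite ltr_wpDl.
have e2 : 0 < e / (2 * (`|x| + 1)) by rewrite divr_gt0 // mulr_gt0.
near \oo => n.
have -> : h - l = (h - u n) + (u n - l) by rewrite addrA subrK.
rewrite dotDr; apply: le_trans (ler_normD _ _) _.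
apply: (@le_trans _ _ (`|x| * n.+1%:R^-1 + `|x| * `|u n - l|)).
  by apply: lerD; [exact: dotu|exact: CauchySchwarz_hilbert].
have h1 : n.+1%:R^-1 <= e / (2 * (`|x| + 1)).
  by apply: ltW; near: n; exact: near_infty_harmonic.
have h2 : `|u n - l| <= e / (2 * (`|x| + 1)).
  by near: n; move/cvgrPdist_le: ul => /(_ _ e2); under eq_near do rewrite distrC.
rewrite -mulrDr; apply: (@le_trans _ _ (`|x| * (e / (`|x| + 1)))).
  rewrite ler_wpM2l //; apply: le_trans (lerD h1 h2) _.
  suff -> : e / (2 * (`|x| + 1)) + e / (2 * (`|x| + 1)) = e / (`|x| + 1) by [].
  by field; rewrite lt0r_neq0.
rewrite mulrCA ler_piMr // ?(ltW e0) // ler_pdivrMr // mul1r lerDl.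
Unshelve. all: by end_near. Qed.
End Dot.

(** * Adjoints, symmetric operators and von Neumann's formula *)

Section SymmetricOperators.
Set Implicit Arguments.
Unset Strict Implicit.
Context {R : realType} {H : completeNormedModType R[i]}.
Variable dot : {dot H for conjC}.
Hypothesis hdot : hilbert_norm dot.
Implicit Types T A : @operator R H.

Lemma has_dim1_span (V : set H) (g x : H) :
  has_dim V 1 -> V g -> g != 0 -> V x -> exists c, x = c *: g.
Proof.
move=> [e [_ _ sp]] /sp[c]; rewrite big_ord1 => -> + /sp[d].
rewrite big_ord1 scaler_eq0 negb_or => /andP[c0 _] ->.
by exists (d ord0 / c ord0); rewrite scalerA divfK.
Qed.

Lemma linear_operatorD T f g : linear_operator T -> dom T f -> dom T g ->
  dom T (f + g) /\ T (f + g) = T f + T g.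
Proof. by move=> [_ lT] Tf Tg; have := lT 1 f g Tf Tg; rewrite !scale1r. Qed.

Lemma linear_operator_act0 T : linear_operator T -> T 0 = 0.
Proof.
move=> [T0 lT]; have [_] := lT 1 0 0 T0 T0.
by rewrite !scale1r addr0 => /eqP; rewrite addrC -subr_eq subrr eq_sym => /eqP.
Qed.

Lemma linear_operatorZ T c f : linear_operator T -> dom T f ->
  dom T (c *: f) /\ T (c *: f) = c *: T f.
Proof.
move=> lT Tf; have [T0 /(_ c f 0 Tf)] := lT.
by rewrite (linear_operator_act0 lT) !addr0; exact.
Qed.

Lemma linear_operatorB T f g : linear_operator T -> dom T f -> dom T g ->
  dom T (f - g) /\ T (f - g) = T f - T g.
Proof.
move=> lT Tf Tg; have [Tg' eg] := linear_operatorZ (-1) lT Tg.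
by have := linear_operatorD lT Tf Tg'; rewrite eg !scaleN1r.
Qed.

(** If [x] were nonzero, some [f] in the domain would satisfy [|x - f| < |x|], while
    [|x|^2 = (x - f, x)] is at most [|x - f| |x|]. *)
Lemma dense_orthogonal0 T x : densely_defined T ->
  (forall f, dom T f -> dot f x = 0) -> x = 0.
Proof.
move=> dT ox; apply: contrapT => /eqP; rewrite -normr_gt0 => x0.
have [f] := dT (ball x `|x|) (ex_intro _ x (ballxx x x0)) (ball_open x _).
rewrite -ball_normE => -[/= xf Tf].
have : `|x| ^+ 2 <= `|x - f| * `|x|.
  rewrite -(ger0_norm (exprn_ge0 2 (normr_ge0 x))) hdot.
  have -> : dot x x = dot (x - f) x by rewrite dotDl dotNl (ox f) // subr0.
  exact: CauchySchwarz_hilbert.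
by rewrite expr2 ler_pM2r // => /le_lt_trans/(_ xf); rewrite ltxx.
Qed.

Lemma adjoint_unique T g h : densely_defined T ->
  adjoint_graph dot T g h -> dom (adjoint dot T) g /\ adjoint dot T g = h.
Proof.
move=> dT gh; split; first by exists h.
have gh' : adjoint_graph dot T g (adjoint dot T g).
  exact: (@xgetPex _ 0 [set h | adjoint_graph dot T g h] (ex_intro _ h gh)).
apply/eqP; rewrite -subr_eq0; apply/eqP; apply: (dense_orthogonal0 dT) => f Tf.
by rewrite dotDr dotNr -gh' // -gh // subrr.
Qed.

Lemma dot_adjoint T f g : dom T f -> dom (adjoint dot T) g ->
  dot (T f) g = dot f (adjoint dot T g).
Proof.
move=> Tf Tg; exact: (@xgetPex _ 0 [set h | adjoint_graph dot T g h]).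
Qed.

Lemma adjoint_linear T : densely_defined T -> linear_operator (adjoint dot T).
Proof.
move=> dT; split; first by exists 0 => f _; rewrite !dot0r.
move=> c f g Tf Tg; apply: adjoint_unique => // x Tx.
by rewrite !dotDr !dotZr !dot_adjoint.
Qed.

Lemma adjoint_sub S T : densely_defined S -> op_sub S T ->
  op_sub (adjoint dot T) (adjoint dot S).
Proof.
move=> dS ST f Tf.
have fS : adjoint_graph dot S f (adjoint dot T f).
  by move=> g /ST[Tg ->]; exact: dot_adjoint.
by have [? ->] := adjoint_unique dS fS.
Qed.

Lemma symmetric_sub_adjoint T : densely_defined T -> symmetric_operator dot T ->
  op_sub T (adjoint dot T).
Proof.
move=> dT sT g Tg.
have gT : adjoint_graph dot T g (T g) by move=> f Tf; exact: sT.
by have [? ->] := adjoint_unique dT gT.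
Qed.

(** Symmetry cancels the cross terms. Hence the norm of [T f + i f] controls both [f] and [T f]. *)
Lemma symmetric_normD_i T f : symmetric_operator dot T -> dom T f ->
  `|T f + 'i *: f| ^+ 2 = `|T f| ^+ 2 + `|f| ^+ 2.
Proof.
move=> sT Tf; rewrite !hdot !(dotDl, dotDr, dotZl, dotZr) conjCi (sT f f) //.
by ring: (sqrCi R[i]).
Qed.

(** If [T f_n + i f_n] tends to [y], the norm identity makes both [f_n] and [T f_n] Cauchy, and the
    closed graph contains their limit. *)
Lemma closed_range_symmetric T : linear_operator T -> closed_operator T ->
  symmetric_operator dot T -> closed [set T f + 'i *: f | f in dom T].
Proof.
move=> lT cT sT y /= cly.
have near_y n : {f | dom T f /\ `|y - (T f + 'i *: f)| < n.+1%:R^-1}.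
  apply: cid; have e0 : 0 < n.+1%:R^-1 :> R[i] by rewrite invr_gt0.
  have [x] := cly (ball y _) (nbhsx_ballx y _ e0).
  by rewrite -ball_normE => -[[f Tf <-]]; exists f.
pose f n := sval (near_y n).
have Tf n : dom T (f n) by have [] := svalP (near_y n).
have yf n : `|y - (T (f n) + 'i *: f n)| <= n.+1%:R^-1.
  by have [_ /ltW] := svalP (near_y n).
have Tff m n : `|T (f m - f n) + 'i *: (f m - f n)| <= m.+1%:R^-1 + n.+1%:R^-1.
  have [_ ->] := linear_operatorB lT (Tf m) (Tf n).
  rewrite (_ : _ + _ = (y - (T (f n) + 'i *: f n)) - (y - (T (f m) + 'i *: f m))).
    apply: le_trans (ler_normB _ _) _; rewrite addrC; exact: lerD.
  by rewrite opprB [RHS]addrC addrA subrK scalerBr opprD addrACA.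
have norm_le g : dom T g -> `|T g| <= `|T g + 'i *: g| /\ `|g| <= `|T g + 'i *: g|.
  move=> Tg; split; rewrite -(@ler_pXn2r _ 2) ?nnegrE // symmetric_normD_i //.
    by rewrite lerDl exprn_ge0.
  by rewrite lerDr exprn_ge0.
have Tfmn m n := linear_operatorB lT (Tf m) (Tf n).
have [l fl] : exists l : H, f n @[n --> \oo] --> l.
  apply: cauchy_harmonic => m n; apply: le_trans (Tff m n).
  by have [_] := norm_le _ (Tfmn m n).1.
have [l' Tfl] : exists l : H, T (f n) @[n --> \oo] --> l.
  apply: cauchy_harmonic => m n; apply: le_trans (Tff m n).
  by have [_ <-] := Tfmn m n; have [] := norm_le _ (Tfmn m n).1.
have [/= Tl eTl] : [set p : H * H | dom T p.1 /\ p.2 = T p.1] (l, l').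
  apply: (@closed_cvg _ _ \oo _ (fun n => (f n, T (f n)))) => //.
    by apply: nearW => n /=.
  exact: cvg_pair.
exists l => //; rewrite -eTl.
have hu : hausdorff_space H by exact: norm_hausdorff.
have c1 : T (f n) + 'i *: f n @[n --> \oo] --> l' + 'i *: l.
  by apply: cvgD => //; apply: cvgZr.
have c2 : T (f n) + 'i *: f n @[n --> \oo] --> y.
  apply/cvgrPdist_le => e e0; near=> n; apply: le_trans (yf n) _; apply: ltW.
  by near: n; exact: near_infty_harmonic.
exact: cvg_unique c1 c2.
Unshelve. all: by end_near. Qed.

Lemma ker_subZ T z c g : linear_operator T -> ker_sub T z g -> ker_sub T z (c *: g).
Proof.
move=> lT [Tg eg]; have [? e] := linear_operatorZ c lT Tg.
by split=> //; rewrite e eg !scalerA mulrC.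
Qed.

(** Project [A^* f + i f] onto the closed range of [A + i]. The residual is orthogonal to that
    range, so it lies in the kernel of [A^* - i] and is a multiple of [gp]. Subtracting the
    projection's preimage and a multiple of [gp] from [f] leaves a vector in the kernel of
    [A^* + i]. *)
Lemma von_neumann_decomposition A gp gm f :
  linear_operator A -> densely_defined A -> closed_operator A ->
  symmetric_operator dot A -> deficiency_indices dot A 1 1 ->
  ker_sub (adjoint dot A) 'i gp -> gp != 0 ->
  ker_sub (adjoint dot A) (- 'i) gm -> gm != 0 ->
  dom (adjoint dot A) f ->
  exists f0 (a b : R[i]), dom A f0 /\ f = f0 + (a *: gp + b *: gm).
Proof.
move=> lA dA cA sA [dp dm] kp gp0 km gm0 Af.
pose M := [set A f + 'i *: f | f in dom A].
have [_ [f0 Af0 <-] of0] : exists2 m, M m & forall x, M x ->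
    dot x (adjoint dot A f + 'i *: f - m) = 0.
  apply: orthogonal_projection => //; last exact: closed_range_symmetric.
    have [A0 _] := lA; exists 0 => //.
    by rewrite linear_operator_act0 // scaler0 addr0.
  move=> c _ _ [x Ax <-] [y Ay <-].
  have [Acxy eq] := (lA.2) c _ _ Ax Ay.
  exists (c *: x + y) => //.
  by rewrite eq !scalerDr scalerA mulrC -scalerA addrACA.
pose h := adjoint dot A f + 'i *: f - (A f0 + 'i *: f0); rewrite -/h in of0.
have kh : ker_sub (adjoint dot A) 'i h.
  apply: adjoint_unique => // x Ax.
  have := of0 _ (ex_intro2 _ _ x Ax erefl).
  rewrite dotDl dotZl => /eqP; rewrite addr_eq0 => /eqP ->.
  by rewrite dotZr conjCi mulNr.
have [mu hmu] := has_dim1_span dp kp gp0 kh.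
have lB := adjoint_linear dA.
have [Bgp egp] := kp; have [Bgm egm] := km.
have [Bf0 ef0] := symmetric_sub_adjoint dA sA Af0.
(* Since [A^* gp = i gp], the operator [A^* + i] multiplies [gp] by [2i]. *)
pose nu := mu / (2 * 'i).
have [Bf1 ef1] := linear_operatorB lB Af Bf0.
have [Bnu enu] := linear_operatorZ nu lB Bgp.
have [Bf2 ef2] := linear_operatorB lB Bf1 Bnu.
have kf : ker_sub (adjoint dot A) (- 'i) (f - f0 - nu *: gp).
  split=> //; rewrite ef2 ef1 enu egp -ef0.
  apply/eqP; rewrite -subr_eq0 scaleNr opprK.
  move: hmu; rewrite /h opprD addrACA -scalerBr => e.
  rewrite scalerBr addrACA e -opprD !scalerA -scalerDl -scalerBl.
  rewrite (_ : _ - _ = 0) ?scale0r // /nu.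
  by field; rewrite neq0Ci.
have [be hbe] := has_dim1_span dm km gm0 kf.
exists f0, nu, be; split => //; rewrite -hbe.
by rewrite [nu *: gp + _]addrC subrK addrC subrK.
Qed.
End SymmetricOperators.

(** * Boundary coordinates and the boundary form *)

Section Boundary.
Set Implicit Arguments.
Unset Strict Implicit.
Context {R : realType} {H : completeNormedModType R[i]}.
Variable dot : {dot H for conjC}.
Hypothesis hdot : hilbert_norm dot.
Variable A : @operator R H.
Hypotheses (A_linear : linear_operator A) (A_dense : densely_defined A)
  (A_closed : closed_operator A) (A_symmetric : symmetric_operator dot A)
  (A_deficiency : deficiency_indices dot A 1 1).
Variables gp gm : H.
Hypotheses (gp_ker : ker_sub (adjoint dot A) 'i gp)
  (gm_ker : ker_sub (adjoint dot A) (- 'i) gm)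
  (gp_norm : dot gp gp = 2^-1) (gm_norm : dot gm gm = 2^-1).
Local Notation As := (adjoint dot A).
Local Notation Hp := (Hplus dot A).

(* Coordinates of f in Dom(A^* )/Dom(A) with respect to g+, g-. *)
Definition coords (f : H) (a b : R[i]) : Prop :=
  exists2 f0, dom A f0 & f = f0 + (a *: gp + b *: gm).

Let As_linear : linear_operator As := adjoint_linear hdot A_dense.

Lemma deficiency_neq0 : gp != 0 /\ gm != 0.
Proof.
split; apply/eqP => g0; [move: gp_norm|move: gm_norm]; rewrite g0 dot0l => /eqP;
by rewrite eq_sym invr_eq0 pnatr_eq0.
Qed.

Lemma coords_ex f : Hp f -> exists a b, coords f a b.
Proof.
have [p0 m0] := deficiency_neq0.
move=> Hf; have [f0 [a [b [Af0 e]]]] := von_neumann_decomposition hdot A_linear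
  A_dense A_closed A_symmetric A_deficiency gp_ker p0 gm_ker m0 Hf.
by exists a, b; exists f0.
Qed.

Lemma Hplus_lin c f g : Hp f -> Hp g -> Hp (c *: f + g).
Proof. by move=> Hf Hg; have [] := As_linear.2 c _ _ Hf Hg. Qed.

Lemma coords_dom f : dom A f -> coords f 0 0.
Proof. by exists f => //; rewrite !scale0r !addr0. Qed.

Lemma coords_comb a b : coords (a *: gp + b *: gm) a b.
Proof. by have [A0 _] := A_linear; exists 0 => //; rewrite add0r. Qed.

Lemma coords00 f : coords f 0 0 -> dom A f.
Proof. by case=> f0 Af0 ->; rewrite !scale0r !addr0. Qed.

Lemma coords_Hplus f a b : coords f a b -> Hp f.
Proof.
move=> [f0 Af0 ->]; rewrite addrC -addrA; apply: Hplus_lin gp_ker.1 _.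
by apply: Hplus_lin gm_ker.1 _; have [] := symmetric_sub_adjoint hdot A_dense A_symmetric Af0.
Qed.

(** Terms involving Dom(A) cancel by symmetry and the definition of the adjoint. Mixed terms in [gp]
    and [gm] cancel because the eigenvalues are conjugate, and the squared norms 1/2 make the
    remaining coefficients [i] and [-i]. *)
Lemma boundary_form f g a b a' b' : coords f a b -> coords g a' b' ->
  dot (As f) g - dot f (As g) = 'i * (a * a'^* - b * b'^*).
Proof.
have actE h c d h0 : dom A h0 -> h = h0 + (c *: gp + d *: gm) ->
    As h = A h0 + (c *: ('i *: gp) - d *: ('i *: gm)).
  move=> Ah0 ->; have [Bh0 ->] := symmetric_sub_adjoint hdot A_dense A_symmetric Ah0.
  have [Bp <-] := gp_ker; have [Bm em] := gm_ker.
  rewrite -(scalerN d) -(scaleNr 'i) -em.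
  have [Bp' ep'] := linear_operatorZ c As_linear Bp.
  have [Bm' em'] := linear_operatorZ d As_linear Bm.
  have [Bpm epm] := linear_operatorD As_linear Bp' Bm'.
  by have [_ ->] := linear_operatorD As_linear Bh0 Bpm; rewrite epm ep' em'.
move=> [f0 Af0 ef] [g0 Ag0 eg].
rewrite (actE _ _ _ _ Af0 ef) (actE _ _ _ _ Ag0 eg) ef eg.
have sp h : dom A h -> dot (A h) gp = - 'i * dot h gp.
  by move=> Ah; rewrite (dot_adjoint Ah gp_ker.1) gp_ker.2 dotZr conjCi.
have sm h : dom A h -> dot (A h) gm = 'i * dot h gm.
  by move=> Ah; rewrite (dot_adjoint Ah gm_ker.1) gm_ker.2 dotZr rmorphN /= conjCi opprK.
have sp' h : dom A h -> dot gp (A h) = 'i * dot gp h.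
  by move=> Ah; rewrite -dotC sp // rmorphM rmorphN /= conjCi opprK dotC.
have sm' h : dom A h -> dot gm (A h) = - 'i * dot gm h.
  by move=> Ah; rewrite -dotC sm // rmorphM /= conjCi dotC.
rewrite !(dotDl, dotDr, dotNl, dotNr, dotZl, dotZr) !sp // !sm // !sp' // !sm' //.
by rewrite (A_symmetric Af0 Ag0) conjCi gp_norm gm_norm; field.
Qed.

Lemma dense_extension S : op_sub A S -> densely_defined S.
Proof.
move=> AS O O0 Oo; have [x [Ox Ax]] := A_dense O0 Oo.
by exists x; split=> //; exact: (AS _ Ax).1.
Qed.

(** Zero coordinates mean membership in Dom(A). Applied both to the quasi-kernel and to the main
    operator. *)
Lemma proper_extension_coords S : op_sub A S -> op_sub S As -> ~ op_sub S A ->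
  exists f a b, [/\ dom S f, coords f a b & (a, b) != (0, 0)].
Proof.
move=> AS SAs nSA; apply: contrapT => nex; apply: nSA => f Sf.
have [Hf _] := SAs _ Sf; have [a [b cf]] := coords_ex Hf.
suff Af : dom A f by split=> //; have [_ ->] := AS _ Af.
apply: coords00; have [[a0 b0]|ab0] := eqVneq (a, b) (0, 0).
  by rewrite a0 b0 in cf.
by case: nex; exists f, a, b.
Qed.

(** * The forms of the state-space operator, its real part and the channel *)

Variable Th : Lsystem dot A.
Local Notation T := (main Th).
Local Notation B := (state Th).
Local Notation rB := (re_pm (state Th)).
Local Notation chi := (channel Th 1).

Lemma state_linl c f g h : Hp f -> Hp g -> Hp h ->
  B (c *: f + g) h = c * B f h + B g h.
Proof.
by move=> Hf Hg Hh; have [[_ + _] _ _ _] := state_star_extension Th; apply.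
Qed.

Lemma state_linr c f g h : Hp f -> Hp g -> Hp h ->
  B h (c *: f + g) = c^* * B h f + B h g.
Proof.
by move=> Hf Hg Hh; have [[/(_ _ Hh)[+ _] _ _] _ _ _] := state_star_extension Th; apply.
Qed.

Lemma re_herm f g : (rB f g)^* = rB g f.
Proof.
rewrite /re_pm /adj_pm rmorphM fmorphV (rmorph_nat conjC) /= [X in _ * X]rmorphD /=.
by rewrite conjCK addrC.
Qed.

Lemma re_linl c f g h : Hp f -> Hp g -> Hp h ->
  rB (c *: f + g) h = c * rB f h + rB g h.
Proof.
move=> Hf Hg Hh; rewrite /re_pm /adj_pm state_linl // state_linr //.
by rewrite rmorphD rmorphM /= conjCK; ring.
Qed.

Lemma channelE c g : Hp g -> channel Th c g = c * chi g.
Proof.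
move=> Hg; have [_ lin _] := channel_bounded Th.
have ch0 : channel Th 0 g = 0.
  have := lin 1 0 0 g Hg; rewrite mul1r addr0 mul1r => /eqP.
  by rewrite addrC -subr_eq subrr eq_sym => /eqP.
by have := lin c 1 0 g Hg; rewrite mulr1 addr0 ch0 addr0.
Qed.

(** This is [AA = Re AA + i Im AA], where the form of [Im AA = K K^*] has rank at most one because
    [K] is determined by [chi = K 1]. *)
Lemma stateE f g : Hp f -> Hp g -> B f g = rB f g + 'i * ((chi f)^* * chi g).
Proof.
move=> Hf Hg; have := @state_im _ _ _ _ Th _ Hf _ Hg; rewrite channelE // => <-.
by rewrite /re_pm /im_pm; field; rewrite neq0Ci.
Qed.

Lemma adj_stateE f g : Hp f -> Hp g ->
  adj_pm B f g = rB f g - 'i * ((chi f)^* * chi g).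
Proof.
move=> Hf Hg; rewrite /adj_pm stateE // rmorphD /= re_herm !rmorphM /= conjCi conjCK.
by ring.
Qed.

(** A self-adjoint extension of [A] is a restriction of [A^*], so the vector of H representing
    [Re AA f] is [A^* f]. *)
Lemma quasi_kernelP f : dom (quasi_kernel dot A rB) f ->
  Hp f /\ forall g, Hp g -> rB f g = dot (As f) g.
Proof.
move=> qf; have [_ _ _ [Aq sq]] := state_star_extension Th.
have [_ e] := adjoint_sub hdot A_dense Aq (sq.1 _ qf).1.
have [Hf ex] := qf; split=> // g Hg.
rewrite -e -(sq.1 _ qf).2.
exact: (@xgetPex _ 0 [set h | eq_minus dot A (rB f) (to_minus dot h)]).
Qed.

Lemma re_dom f g : dom A f -> Hp g -> rB f g = dot (As f) g.
Proof.
move=> Af; have [_ _ _ [Aq _]] := state_star_extension Th.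
by apply: (quasi_kernelP (Aq _ Af).1).2.
Qed.

(** Self-adjointness forces a boundary vector outside Dom(A), and its boundary form with itself
    vanishes, so its coordinates have equal modulus. Replacing [gm] by [u *: gm] gives any L-system
    the normalization assumed for [Th]. *)
Lemma quasi_kernel_unimodular : exists u : R[i], u * u^* = 1 /\
  forall g, Hp g -> rB (gp - u *: gm) g = dot (As (gp - u *: gm)) g.
Proof.
have [_ _ _ [Aq sq]] := state_star_extension Th.
set q := quasi_kernel dot A rB in Aq sq.
have qAs f : dom q f -> q f = As f.
  by move=> qf; rewrite (sq.1 _ qf).2; exact: (adjoint_sub hdot A_dense Aq (sq.1 _ qf).1).2.
have [f [a [b [qf cf ab0]]]] : exists f a b,
    [/\ dom q f, coords f a b & (a, b) != (0, 0)].
  apply: proper_extension_coords => // [f qf|qA].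
    by split; [exact: (quasi_kernelP qf).1|exact: qAs].
  have q_dense := dense_extension Aq.
  (* Otherwise A is self-adjoint, against A^* g+ = i g+. *)
  have Agp : dom A gp.
    apply: (qA gp _).1; apply: (sq.2 gp _).1.
    exact: (adjoint_sub hdot q_dense qA gp_ker.1).1.
  have Agm := coords_dom Agp.
  have cgp : coords gp 1 0 by have := coords_comb 1 0; rewrite scale1r scale0r addr0.
  have := boundary_form Agm cgp; rewrite (boundary_form cgp cgp) => /eqP.
  rewrite rmorph0 rmorph1 mulr1 !mul0r !subr0 mulr0 mulr1.
  by rewrite (negPf (neq0Ci _)).
have [Hf rf] := quasi_kernelP qf.
have abn : a * a^* = b * b^*.
  apply/eqP; rewrite -subr_eq0 -(mulrI_eq0 _ (mulfI (neq0Ci _))) -(boundary_form cf cf).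
  rewrite -qAs // subr_eq0 (dot_adjoint qf (sq.1 _ qf).1).
  by rewrite -(sq.1 _ qf).2.
have a0 : a != 0.
  apply: contra_neq ab0 => a0; move: abn; rewrite a0 mul0r => /esym/eqP.
  by rewrite mul_conjC_eq0 => /eqP ->.
(* Removing the Dom(A) part of [f] and dividing by [a] leaves [gp + (b / a) *: gm]. *)
exists (- b / a); split.
  rewrite rmorphM fmorphV rmorphN /= mulrACA mulrNN -abn -invfM divff //.
  by rewrite mul_conjC_eq0.
move=> g Hg; have [f0 Af0 ef] := cf; have Hf0 := coords_Hplus (coords_dom Af0).
have -> : gp - (- b / a) *: gm = a^-1 *: (-1 *: f0 + f).
  rewrite ef addrA scaleN1r addNr add0r scalerDr !scalerA mulVf // scale1r.
  by rewrite mulNr scaleNr opprK [b / a]mulrC.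
have Hd := Hplus_lin (-1) Hf0 Hf.
have [A0 _] := A_linear; have H0 := coords_Hplus (coords_dom A0).
have linf : rB (-1 *: f0 + f) g = dot (As (-1 *: f0 + f)) g.
  rewrite re_linl // rf // re_dom //.
  by have [_ ->] := As_linear.2 (-1) _ _ Hf0 Hf; rewrite dotDl dotZl.
have := re_linl a^-1 Hd H0 Hg; rewrite addr0 => ->.
have [_ ->] := linear_operatorZ a^-1 As_linear Hd.
by rewrite linf dotZl re_dom // linear_operator_act0 // dot0l addr0.
Qed.

(** * Normal form of [Re AA] when it agrees with [A^*] at [gp - gm] *)

Hypothesis qk_psi : forall g, Hp g -> rB (gp - gm) g = dot (As (gp - gm)) g.

Definition boundary_functional (r : R) (a b : R[i]) : R[i] :=
  - 'i * (a - b)^* + r%:C / 2 * (a + b)^*.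
Local Notation om := boundary_functional.

Definition re_boundary (r : R) : Prop := forall f g a b a' b',
  coords f a b -> coords g a' b' ->
  rB f g = dot (As f) g + (a + b) / 2 * om r a' b'.

Lemma coords_psi : coords (gp - gm) 1 (-1).
Proof. by have := coords_comb 1 (-1); rewrite scale1r scaleN1r. Qed.

(** Split both arguments along [gp + gm] and [gp - gm]. Only the first direction sees a difference
    between [Re AA] and [A^*]; hermitian symmetry and the boundary form determine that difference up
    to one number. *)
Lemma re_boundary_ex : exists r, re_boundary r.
Proof.
pose phi := 1 *: gp + 1 *: gm.
have cphi : coords phi 1 1 by exact: coords_comb.
have Hphi := coords_Hplus cphi; have Hpsi := coords_Hplus coords_psi.
have decomp f a b : coords f a b -> exists fs,
    [/\ coords fs ((a - b) / 2) (- ((a - b) / 2)), f = ((a + b) / 2) *: phi + fs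
      & forall g, Hp g -> rB fs g = dot (As fs) g].
  move=> [f0 Af0 ->]; exists (f0 + ((a - b) / 2) *: (gp - gm)).
  have Hf0 := coords_Hplus (coords_dom Af0).
  split; first by exists f0 => //; rewrite scaleNr scalerBr.
    rewrite [RHS]addrCA; congr (_ + _); rewrite /phi !scale1r scalerDr scalerBr addrACA.
    by rewrite -scalerDl -scalerBl; congr (_ *: _ + _ *: _); field.
  move=> g Hg; rewrite addrC re_linl // qk_psi // re_dom //.
  by have [_ ->] := As_linear.2 ((a - b) / 2) _ _ Hpsi Hf0; rewrite dotDl dotZl.
pose rr := rB phi phi - dot (As phi) phi.
(* The boundary form of [phi] with itself vanishes since its coordinates are equal; with hermitian
   symmetry this makes [rr] real. *)
have phi_sym : dot phi (As phi) = dot (As phi) phi.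
  apply/eqP; rewrite eq_sym -subr_eq0 (boundary_form cphi cphi).
  by rewrite subrr mulr0.
have rrE : (complex.Re rr)%:C = rr.
  by apply/RRe_real/CrealP; rewrite rmorphB /= re_herm dotC phi_sym.
exists (complex.Re rr) => f g a b a' b' cf cg.
have [fs [cfs ef rfs]] := decomp _ _ _ cf; have [gs [cgs eg rgs]] := decomp _ _ _ cg.
have Hfs := coords_Hplus cfs; have Hgs := coords_Hplus cgs.
have Hg := coords_Hplus cg.
have phig : rB phi g = dot (As phi) g + om (complex.Re rr) a' b'.
  rewrite -[LHS]re_herm [in LHS]eg re_linl // rmorphD rmorphM /= re_herm.
  rewrite rgs // dotC [in RHS]eg dotDr dotZr /om rrE.
  have := boundary_form cphi cgs => /eqP; rewrite subr_eq => /eqP ->.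
  rewrite !rmorphN /= !conjC_half /rr !(rmorphB, rmorphD) /=.
  by field.
rewrite [in LHS]ef re_linl // phig rfs //.
have [_ eAf] := As_linear.2 ((a + b) / 2) _ _ Hphi Hfs.
by rewrite -ef in eAf; rewrite eAf dotDl dotZl; ring.
Qed.

Lemma om00 r : om r 0 0 = 0.
Proof. by rewrite /om subr0 addr0 rmorph0 !mulr0 addr0. Qed.

Lemma om_psi r : om r 1 (-1) = - 2 * 'i.
Proof. by rewrite /om subrr opprK rmorph0 mulr0 addr0 (rmorph_nat conjC 2); ring. Qed.

(** Lets coefficients of multiples of the functional be compared by evaluating at [gp - gm]. *)
Lemma om_psi_neq0 r : om r 1 (-1) != 0.
Proof. by rewrite om_psi mulf_neq0 ?neq0Ci // oppr_eq0 pnatr_eq0. Qed.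

Lemma conj_om r a b : (om r a b)^* = 'i * (a - b) + r%:C / 2 * (a + b).
Proof.
rewrite /om rmorphD !rmorphM /= !conjCK rmorphN /= conjCi opprK.
by rewrite fmorphV (rmorph_nat conjC) conjC_realc.
Qed.

Lemma main_stateE f g : dom T f -> Hp g ->
  rB f g + 'i * ((chi f)^* * chi g) = dot (As f) g.
Proof.
move=> Tf Hg; have [_ [_ sT] _ _] := state_star_extension Th.
have [Hf e] := sT _ Tf; rewrite -stateE // e // /to_minus.
by have [_ ->] := main_upper Tf.
Qed.

Lemma adjoint_main_sub f : dom (adjoint dot T) f ->
  Hp f /\ adjoint dot T f = As f.
Proof. by move=> Tf; have [_ [AT _] _ _] := state_star_extension Th; exact: adjoint_sub Tf. Qed.

Lemma adjoint_main_stateE f g : dom (adjoint dot T) f -> Hp g ->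
  rB f g - 'i * ((chi f)^* * chi g) = dot (As f) g.
Proof.
move=> Tf Hg; have [_ _ [_ sT] _] := state_star_extension Th.
have [Hf e] := sT _ Tf; rewrite -adj_stateE // e // /to_minus.
by have [_ <-] := adjoint_main_sub Tf.
Qed.

(** On Dom(A) both [AA] and [Re AA] act as [A^*], so the rank-one term gives [|chi f|^2 = 0]. *)
Lemma chi_dom f : dom A f -> chi f = 0.
Proof.
move=> Af; have Hf := coords_Hplus (coords_dom Af).
have := main_stateE (main_lower Th Af).1 Hf; rewrite re_dom // => /eqP.
rewrite -subr_eq0 [X in X - _]addrC addrK mulrC mulf_eq0 (negPf (neq0Ci _)) orbF.
by rewrite mulf_eq0 conjC_eq0 orbb => /eqP.
Qed.

(** * Boundary equations of the main operator; impedance at [i] and transfer at [-i] *)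

Section NormalForm.
Variable r : R.
Hypothesis rBE : re_boundary r.

(** On Dom(T), [AA] acts as [A^*], so the corrections from [Re AA] and from [i K K^*] must cancel.
    This is the linear equation on [(a, b)] that cuts [T] out of [A^*]. *)
Lemma main_boundary f g a b a' b' : dom T f -> coords f a b -> coords g a' b' ->
  (a + b) / 2 * om r a' b' + 'i * ((chi f)^* * chi g) = 0.
Proof.
move=> Tf cf cg; have := main_stateE Tf (coords_Hplus cg).
rewrite (rBE cf cg) => /eqP; rewrite -subr_eq0 => /eqP <-.
by ring.
Qed.

(** The sign changes because [AA^*] is [Re AA - i Im AA]. *)
Lemma adjoint_main_boundary f g a b a' b' : dom (adjoint dot T) f ->
  coords f a b -> coords g a' b' ->
  (a + b) / 2 * om r a' b' - 'i * ((chi f)^* * chi g) = 0.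
Proof.
move=> Tf cf cg; have := adjoint_main_stateE Tf (coords_Hplus cg).
rewrite (rBE cf cg) => /eqP; rewrite -subr_eq0 => /eqP <-.
by ring.
Qed.

Definition chi_boundary (c : R[i]) : Prop :=
  forall g a b, coords g a b -> chi g = c * om r a b.

Lemma deficiency_eq z f : dom As f ->
  (forall g, dom A g -> dot (As f) g - z * dot f g = 0) -> ker_sub As z f.
Proof.
move=> Hf oA; split=> //; apply/eqP; rewrite -subr_eq0; apply/eqP.
apply: (dense_orthogonal0 hdot A_dense) => g Ag.
by rewrite -dotC dotDl dotNl dotZl oA // rmorph0.
Qed.

(** Tested against Dom(A), where [chi] and the boundary functional vanish, the equation puts [f] in
    the kernel of [A^* - i]. Tested against all of Dom(A^* ), it then identifies [chi]. *)
Lemma impedance_solution f : Hp f ->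
  (forall g, Hp g -> rB f g - 'i * dot f g = chi g) ->
  exists s, f = s *: gp /\ forall g a b, coords g a b -> chi g = s / 2 * om r a b.
Proof.
move=> Hf ef; have [a [b cf]] := coords_ex Hf.
have kf : ker_sub As 'i f.
  apply: deficiency_eq => // g Ag.
  have := ef _ (coords_Hplus (coords_dom Ag)).
  by rewrite (rBE cf (coords_dom Ag)) om00 mulr0 addr0 chi_dom.
have [s fs] := has_dim1_span A_deficiency.1 gp_ker deficiency_neq0.1 kf.
have cs : coords f s 0 by have := coords_comb s 0; rewrite scale0r addr0 -fs.
exists s; split=> // g a' b' cg; rewrite -(ef _ (coords_Hplus cg)) (rBE cs cg).
by rewrite kf.2 dotZl addr0; ring.
Qed.

Lemma impedance_neq0 : impedance Th 'i != 0 -> exists c, chi_boundary c.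
Proof.
rewrite /impedance /resolvent_pm; set P := [set f | _].
case: (pselect (exists f, P f)) => [[f [Hf ef]] _|nP].
  by have [s [_ es]] := impedance_solution Hf ef; exists (s / 2).
(* Without a solution the resolvent takes its default value 0, and the impedance would vanish. *)
rewrite xgetPN => [|f Pf]; last by apply: nP; exists f.
by rewrite /adj_cm chi_dom ?rmorph0 ?eqxx //; exact: A_linear.1.
Qed.

(** The vector [2c gp] solves the resolvent equation, and evaluation at [gp - gm] shows that it is
    the only solution. *)
Lemma impedance_boundary c : chi_boundary c ->
  impedance Th 'i = c * c^* * (2 * 'i + r%:C).
Proof.
move=> cE; rewrite /impedance /resolvent_pm; set P := [set f | _].
have cc : coords ((2 * c) *: gp) (2 * c) 0.
  by have := coords_comb (2 * c) 0; rewrite scale0r addr0.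
have Pc : P ((2 * c) *: gp).
  split; first exact: coords_Hplus cc.
  move=> g Hg; have [a [b cg]] := coords_ex Hg.
  rewrite (rBE cc cg) (cE _ _ _ cg) /to_minus addr0.
  have [_ ->] := linear_operatorZ (2 * c) As_linear gp_ker.1.
  by rewrite gp_ker.2 !dotZl; field.
have [Hf ef] := xgetPex 0 (ex_intro _ _ Pc).
have [s [-> es]] := impedance_solution Hf ef.
have s2c : s = 2 * c.
  have := es _ _ _ coords_psi; rewrite (cE _ _ _ coords_psi).
  by move/(mulIf (om_psi_neq0 r)) => ->; field.
by rewrite s2c /adj_cm (cE _ _ _ cc) rmorphM /= conj_om; field.
Qed.

(** At [-i] the solution is a multiple of [gm], by the same test against Dom(A). *)
Lemma transfer_boundary c : r = 0 -> chi_boundary c ->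
  transfer Th (- 'i) = (1 - 2 * (c * c^*)) / (1 + 2 * (c * c^*)).
Proof.
move=> r0 cE; rewrite /transfer /resolvent_pm; set P := [set f | _].
have p0 : 1 + 2 * (c * c^*) != 0.
  by rewrite lt0r_neq0 // ltr_pwDl // mulr_ge0 // mul_conjC_ge0.
(* The coefficient solves [t / 2 + |c|^2 t = c]. *)
pose t := 2 * c / (1 + 2 * (c * c^*)).
have cgm s : coords (s *: gm) 0 s.
  by have := coords_comb 0 s; rewrite scale0r add0r.
have chigm s : (chi (s *: gm))^* = - 'i * c^* * s.
  by rewrite (cE _ _ _ (cgm s)) rmorphM /= conj_om r0; ring.
have Asgm s : As (s *: gm) = - 'i *: (s *: gm).
  have [_ ->] := linear_operatorZ s As_linear gm_ker.1.
  by rewrite gm_ker.2 !scalerA mulrC.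
have BgmE s g a b : coords g a b ->
    B (s *: gm) g - (- 'i) * dot (s *: gm) g = (s / 2 + c * c^* * s) * om r a b.
  move=> cg; rewrite stateE; [|exact: coords_Hplus (cgm s)|exact: coords_Hplus cg].
  rewrite (rBE (cgm s) cg) (cE _ _ _ cg) chigm Asgm dotZl.
  by ring: (sqrCi R[i]).
have Pt : P (t *: gm).
  split; first exact: coords_Hplus (cgm t).
  move=> g Hg; have [a [b cg]] := coords_ex Hg.
  by rewrite /to_minus (BgmE _ _ _ _ cg) (cE _ _ _ cg) /t; field.
have [Hf ef] := xgetPex 0 (ex_intro _ _ Pt); move: Hf ef.
set f := xget 0 P => Hf ef.
have kf : ker_sub As (- 'i) f.
  apply: deficiency_eq => // g Ag; have [a [b cf]] := coords_ex Hf.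
  have Hg := coords_Hplus (coords_dom Ag).
  have := ef _ Hg; rewrite stateE // (rBE cf (coords_dom Ag)) om00 (chi_dom Ag) /to_minus.
  by rewrite !mulr0 !addr0.
have [s fs] := has_dim1_span A_deficiency.2 gm_ker deficiency_neq0.2 kf.
have st : s / 2 + c * c^* * s = c.
  apply: (mulIf (om_psi_neq0 r)).
  have := ef _ (coords_Hplus coords_psi).
  by rewrite fs /to_minus (BgmE _ _ _ _ coords_psi) (cE _ _ _ coords_psi).
rewrite fs /adj_cm chigm.
have -> : s = t by rewrite /t -{1}st; field.
by rewrite /t; field: (sqrCi R[i]).
Qed.
End NormalForm.

(** The boundary equation at [gp - k gm] makes [chi] a multiple [c] of the boundary functional and
    gives one complex equation in the real numbers [|c|^2] and [r]. With its conjugate it yields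
    [r = 0] and [2|c|^2 = (1 - k)/(1 + k)]. *)
Lemma main_parameter_values (k : R) : 0 <= k < 1 -> dom T (gp - k%:C *: gm) ->
  impedance Th 'i = 'i * ((1 - k) / (1 + k))%:C /\ transfer Th (- 'i) = k%:C.
Proof.
move=> /andP[k0 k1] Tf; have [r rBE] := re_boundary_ex.
set f := gp - k%:C *: gm in Tf.
have cf : coords f 1 (- k%:C) by have := coords_comb 1 (- k%:C); rewrite scale1r scaleNr.
have k1' : 1 - k%:C != 0.
  by rewrite -(rmorph1 (real_complex R)) -rmorphB fmorph_eq0 subr_eq0 eq_sym lt_eqF.
have k1p : 1 + k%:C != 0.
  by rewrite -(rmorph1 (real_complex R)) -rmorphD fmorph_eq0 lt0r_neq0 // ltr_wpDr.
(* Otherwise the boundary equation at [gp - gm] would force [1 - k = 0]. *)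
have chif0 : (chi f)^* != 0.
  apply: contraNneq (om_psi_neq0 r) => chi0.
  have := main_boundary rBE Tf cf coords_psi; rewrite chi0 mul0r mulr0 addr0 => /eqP.
  by rewrite mulf_eq0 mulf_eq0 (negPf k1') invr_eq0 pnatr_eq0.
pose c := 'i * (1 - k%:C) / 2 / (chi f)^*.
have cE : chi_boundary r c.
  move=> g a b cg; have := main_boundary rBE Tf cf cg => /eqP; rewrite addr_eq0.
  move=> /eqP e; rewrite /c.
  transitivity ('i * ((1 - k%:C) / 2 * boundary_functional r a b) / (chi f)^*); last by field.
  by rewrite e; field: (sqrCi R[i]).
set p := c * c^*.
have pr : p^* = p by rewrite /p rmorphM /= conjCK mulrC.
have e1 : p * ('i * (1 + k%:C) + r%:C / 2 * (1 - k%:C)) = 'i * (1 - k%:C) / 2.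
  transitivity (c * (chi f)^*); last by rewrite /c divfK.
  by rewrite (cE _ _ _ cf) rmorphM /= conj_om /p opprK mulrA.
have e2 : p * (- 'i * (1 + k%:C) + r%:C / 2 * (1 - k%:C)) = - 'i * (1 - k%:C) / 2.
  have := congr1 conjC e1; rewrite [LHS]rmorphM /= pr.
  rewrite !(rmorphM, rmorphD, rmorphN, rmorph1) /= conjCi fmorphV (rmorph_nat conjC).
  by rewrite !conjC_realc.
have p1 : p * (1 + k%:C) = (1 - k%:C) / 2.
  apply: (mulfI (neq0Ci R[i])).
  transitivity ((p * ('i * (1 + k%:C) + r%:C / 2 * (1 - k%:C)) -
    p * (- 'i * (1 + k%:C) + r%:C / 2 * (1 - k%:C))) / 2); first by field.
  by rewrite e1 e2; field.
have p0 : p != 0.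
  apply: contraNneq k1' => p0; move: p1; rewrite p0 mul0r => /esym/eqP.
  by rewrite mulf_eq0 invr_eq0 pnatr_eq0 orbF.
have r0 : r = 0.
  have /eqP : r%:C * (1 - k%:C) = 0.
    apply: (mulfI p0); rewrite mulr0.
    transitivity (p * ('i * (1 + k%:C) + r%:C / 2 * (1 - k%:C)) +
      p * (- 'i * (1 + k%:C) + r%:C / 2 * (1 - k%:C))); first by field.
    by rewrite e1 e2; field.
  by rewrite mulf_eq0 (negPf k1') orbF fmorph_eq0 => /eqP.
have pE : p = (1 - k%:C) / (1 + k%:C) / 2.
  by apply: (mulIf k1p); rewrite p1; field.
split.
  rewrite (impedance_boundary rBE cE) -/p r0 pE rmorphM fmorphV rmorphB rmorphD rmorph1 /=.
  by field.
rewrite (transfer_boundary rBE r0 cE) -/p pE.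
field; rewrite k1p.
rewrite (_ : _ + _ = 2); last by ring.
by rewrite pnatr_eq0.
Qed.

(** * The main operator and dissipation coefficient determined by [V(i) = Q + ia] *)

Section PerturbedMain.
Variables a Q : R.
Hypotheses (a_gt0 : 0 < a) (impedance_aQ : impedance Th 'i = Q%:C + 'i * a%:C).
(** With [v = V(i)], this is [(1 + i v) / (1 + i v^* )]. *)
Definition perturbed_kappa : R[i] :=
  (1 - a%:C + 'i * Q%:C) / (1 + a%:C + 'i * Q%:C).
Local Notation kappa := perturbed_kappa.

Lemma kappa_den : 1 + a%:C + 'i * Q%:C != 0.
Proof.
rewrite -(rmorph1 (real_complex R)) -rmorphD complexDi eq_complex /= negb_and.
by rewrite lt0r_neq0 // addr_gt0.
Qed.

Lemma kappa_norm : kappa * kappa^* =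
  (((1 - a) ^+ 2 + Q ^+ 2) / ((1 + a) ^+ 2 + Q ^+ 2))%:C.
Proof.
have d0 := kappa_den; have d0' : 1 + a%:C - 'i * Q%:C != 0.
  rewrite -conjC_eq0 rmorphB rmorphM rmorphD rmorph1 /= !conjC_realc conjCi.
  by rewrite mulNr opprK.
have -> : kappa^* = (1 - a%:C - 'i * Q%:C) / (1 + a%:C - 'i * Q%:C).
  rewrite /kappa rmorphM fmorphV !(rmorphD, rmorphN, rmorph1) /= rmorphM /= conjCi.
  by rewrite !conjC_realc mulNr.
have -> : (((1 - a) ^+ 2 + Q ^+ 2) / ((1 + a) ^+ 2 + Q ^+ 2))%:C =
    ((1 - a%:C) ^+ 2 + Q%:C ^+ 2) / ((1 + a%:C) ^+ 2 + Q%:C ^+ 2).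
  by rewrite rmorphM fmorphV !(rmorphD, rmorphXn) /= !(rmorphD, rmorphN, rmorph1).
have -> : (1 + a%:C) ^+ 2 + Q%:C ^+ 2 = (1 + a%:C + 'i * Q%:C) * (1 + a%:C - 'i * Q%:C).
  by ring: (sqrCi R[i]).
have -> : (1 - a%:C) ^+ 2 + Q%:C ^+ 2 = (1 - a%:C + 'i * Q%:C) * (1 - a%:C - 'i * Q%:C).
  by ring: (sqrCi R[i]).
by rewrite /kappa; field; rewrite d0 d0'.
Qed.

(** Comparing [V(i) = p (2i + r)] with [Q + ia] gives [2p = a] and [p r = Q], which turns the
    boundary equation into [y = - kappa x]. Since [T] is strictly larger than [A], it contains such
    a vector outside Dom(A). *)
Lemma main_perturbed : dom T (gp - kappa *: gm) /\
  forall f x y, dom T f -> coords f x y -> y = - kappa * x.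
Proof.
have [r rBE] := re_boundary_ex.
have [c cE] : exists c, chi_boundary r c.
  apply: impedance_neq0 => //.
  by rewrite impedance_aQ complexDi eq_complex /= negb_and orbC lt0r_neq0.
set p := c * c^*.
have pr : p^* = p by rewrite /p rmorphM /= conjCK mulrC.
have e1 := impedance_boundary rBE cE; rewrite impedance_aQ -/p in e1.
have e2 : Q%:C - 'i * a%:C = p * (- 2 * 'i + r%:C).
  have := congr1 conjC e1; rewrite [RHS]rmorphM !rmorphD (rmorphM _ 2) (rmorphM _ 'i) /=.
  by rewrite pr conjCi !conjC_realc (rmorph_nat conjC 2) mulrN mulNr mulNr.
have pa : 2 * p = a%:C.
  apply: (mulfI (neq0Ci R[i])).
  transitivity ((p * (2 * 'i + r%:C) - p * (- 2 * 'i + r%:C)) / 2); first by field.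
  by rewrite -e1 -e2; field.
have pQ : p * r%:C = Q%:C.
  transitivity ((p * (2 * 'i + r%:C) + p * (- 2 * 'i + r%:C)) / 2); first by field.
  by rewrite -e1 -e2; field.
have c0 : c != 0.
  apply: contraTneq a_gt0 => c0; move: pa; rewrite /p c0 mul0r mulr0.
  by move/eqP; rewrite eq_sym fmorph_eq0 => /eqP ->; rewrite ltxx.
have Ty f x y : dom T f -> coords f x y -> y = - kappa * x.
  move=> Tf cf; have := main_boundary rBE Tf cf coords_psi.
  rewrite (cE _ _ _ cf) (cE _ _ _ coords_psi) rmorphM /= conj_om.
  set o := boundary_functional r 1 (-1) => e.
  have : (x + y) + (- (2 * p) * (x - y) + 'i * (p * r%:C) * (x + y)) = 0.
    apply: (mulIf (om_psi_neq0 r)); rewrite mul0r -[RHS](mulr0 2) -e /p -/o.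
    by field: (sqrCi R[i]).
  rewrite pa pQ => e3; apply: (mulIf kappa_den).
  rewrite /kappa -[LHS]addr0 -[X in _ + X]oppr0 -e3.
  by field; exact: kappa_den.
split=> //.
have [f [x [y [Tf cf xy0]]]] : exists f x y,
    [/\ dom T f, coords f x y & (x, y) != (0, 0)].
  apply: proper_extension_coords; [exact: main_lower|exact: main_upper|move=> TA].
  have T_dense := dense_extension (@main_lower _ _ _ _ Th).
  (* If T = A then AA^* extends T^* = A^*; as Re AA agrees with A^* at g+ - g-,
     Im AA vanishes there, but K^* does not. *)
  have Tpsi := (adjoint_sub hdot T_dense TA (coords_Hplus coords_psi)).1.
  have := adjoint_main_boundary rBE Tpsi coords_psi coords_psi.
  rewrite subrr !mul0r sub0r => /eqP; rewrite oppr_eq0 mulf_eq0 (negPf (neq0Ci _)) /=.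
  rewrite mulf_eq0 conjC_eq0 orbb (cE _ _ _ coords_psi) mulf_eq0 (negPf c0).
  by rewrite (negPf (om_psi_neq0 _)).
have yE := Ty _ _ _ Tf cf.
(* If [x] vanished, so would [y]; thus the vector can be scaled to first coordinate 1 after removing
   its Dom(A) part. *)
have x0 : x != 0 by apply: contra_neq xy0 => x0; rewrite yE x0 mulr0.
have [f0 Af0 ef] := cf.
have lT := main_linear Th.
have [Td _] := linear_operatorB lT Tf (main_lower Th Af0).1.
have [+ _] := linear_operatorZ x^-1 lT Td.
rewrite ef addrC addrA addNr add0r scalerDr !scalerA mulVf // scale1r yE.
by rewrite mulrCA mulVf // mulr1 scaleNr.
Qed.

(** The boundary form of [f] with itself is [2i] times the imaginary part. *)
Lemma Im_main f x y : dom T f -> coords f x y ->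
  (complex.Im (dot (T f) f))%:C = (x * x^* - y * y^*) / 2.
Proof.
move=> Tf cf; have [Hf ->] := main_upper Tf.
rewrite complexIm ImE.
rewrite -[(dot _ _)^*]opprK -opprB opprK dotC (boundary_form cf cf).
by field: (sqrCi R[i]).
Qed.

Lemma norm1_dot (x : H) : `|x| = 1 <-> dot x x = 1.
Proof.
rewrite -hdot; split=> [->|/eqP]; first by rewrite expr1n.
by rewrite sqrp_eq1 // => /eqP.
Qed.

(** A unit [g] is [s gp] with [|s|^2 = 2], and the second coordinate is [- kappa s], so the value is
    [1 - |kappa|^2] for every admissible basis. *)
Lemma Im_main_unit (g h : H) (k : R) : `|g| = 1 ->
  ker_sub As 'i g -> ker_sub As (- 'i) h -> dom T (g - k%:C *: h) ->
  complex.Im (dot (T (g - k%:C *: h)) (g - k%:C *: h)) =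
    4 * a / ((1 + a) ^+ 2 + Q ^+ 2).
Proof.
move=> /norm1_dot g1 kg kh Tf.
have [p0 m0] := deficiency_neq0.
have [s es] := has_dim1_span A_deficiency.1 gp_ker p0 kg.
have [t et] := has_dim1_span A_deficiency.2 gm_ker m0 kh.
have ss : s * s^* = 2.
  move: g1; rewrite es dotZl dotZr gp_norm => e.
  transitivity (2 * (s * (s^* / 2))); first by field.
  by rewrite e mulr1.
have cf : coords (g - k%:C *: h) s (- (k%:C * t)).
  by rewrite es et -scaleNr scalerA mulNr; exact: coords_comb.
have kt : k%:C * t = kappa * s.
  by apply: oppr_inj; rewrite (main_perturbed.2 _ _ _ Tf cf) mulNr.
have n0 : (1 + a) ^+ 2 + Q ^+ 2 != 0.
  by rewrite lt0r_neq0 // ltr_wpDr ?sqr_ge0 // exprn_gt0 // addr_gt0.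
apply: complexI; rewrite (Im_main Tf cf) kt.
transitivity (1 - kappa * kappa^*).
  transitivity (s * s^* * (1 - kappa * kappa^*) / 2); last by rewrite ss; field.
  by rewrite rmorphN (rmorphM _ _ s) /=; ring.
rewrite kappa_norm -(rmorph1 (real_complex R)) -rmorphB; congr (_%:C).
by field.
Qed.

Lemma dissipation_perturbed D : Q != 0 ->
  dissipation_coefficient Th D <-> D = 4 * a / ((1 + a) ^+ 2 + Q ^+ 2).
Proof.
move=> Q0; split=> [[g [h [k [[g1 h1] [[kg kh _ _] Tf] _ ->]]]]|->].
  exact: Im_main_unit.
have d0 : 0 < (1 + a) ^+ 2 + Q ^+ 2.
  by rewrite ltr_wpDr ?sqr_ge0 // exprn_gt0 // addr_gt0.
have n0 : 0 < (1 - a) ^+ 2 + Q ^+ 2.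
  by rewrite ltr_wpDl ?sqr_ge0 // exprn_even_gt0.
have k0 : kappa != 0.
  by rewrite -mul_conjC_eq0 kappa_norm fmorph_eq0 lt0r_neq0 // divr_gt0.
have cabsE : (cabs kappa)%:C = `|kappa| by rewrite /cabs RRe_real // normr_real.
have sq2 : sqrtC 2 * (sqrtC 2)^* = 2 :> R[i].
  by rewrite geC0_conj ?sqrtC_ge0 // -expr2 sqrtCK.
(* The factor [sqrtC 2] makes the vectors unit, and the phase of [kappa], defined as [Q] is nonzero,
   turns the parameter into [|kappa|]. *)
pose g := sqrtC 2 *: gp; pose v : R[i] := sqrtC 2 * (kappa / `|kappa|).
have g1 : `|g| = 1 by apply/norm1_dot; rewrite /g dotZl dotZr gp_norm mulrA sq2 divff.
have v2 : v * v^* = 2.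
  by rewrite /v (rmorphM _ (sqrtC 2)) /= mulrACA sq2 norm_direction_conj // mulr1.
have h1 : `|v *: gm| = 1.
  by apply/norm1_dot; rewrite dotZl dotZr gm_norm mulrA v2 divff.
have kg : ker_sub As 'i g by exact: ker_subZ.
have kh : ker_sub As (- 'i) (v *: gm) by exact: ker_subZ.
have fE : g - (cabs kappa)%:C *: (v *: gm) = sqrtC 2 *: (gp - kappa *: gm).
  rewrite scalerBr cabsE !scalerA /v; congr (_ - _ *: _).
  by rewrite mulrCA [`|_| * _]mulrC divfK // normr_eq0.
have Tf : dom T (g - (cabs kappa)%:C *: (v *: gm)).
  by rewrite fE; exact: (linear_operatorZ _ (main_linear Th) main_perturbed.1).1.
exists g, (v *: gm), (cabs kappa); split=> //.
- by split=> //; split=> //; [rewrite -normr_gt0 g1|rewrite g1 h1].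
- rewrite -ler0c cabsE normr_ge0 -lecR cabsE /=.
  rewrite -(@expr_le1 _ 2) // normCK kappa_norm lecR ler_pdivrMr // mul1r lerD2r.
  rewrite -subr_ge0 (_ : _ - _ = 4 * a) ?mulr_ge0 ?ltW //.
  by ring.
- exact/esym/(Im_main_unit g1 kg kh Tf).
Qed.
End PerturbedMain.
End Boundary.

(** * Closed formulas and conclusion *)

Lemma tanh_half_entropy (R : realType) (k : R) : 0 < k ->
  tanh (- ln k / 2) = (1 - k) / (1 + k).
Proof.
move=> k0; rewrite /tanh expRN; set x := expR _.
have x0 : 0 < x by exact: expR_gt0.
have x2 : k = x^-1 ^+ 2.
  by rewrite /x -expRN expr2 -expRD -mulNr opprK -splitr lnK.
by rewrite x2; field; rewrite !lt0r_neq0 // ltr_wpDl ?sqr_ge0.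
Qed.

(** After cross-multiplication this is a polynomial identity modulo [r^2 = b^2 + 4 Q^2]; positivity
    of [Z] keeps the left denominator nonzero. *)
Lemma dissipation_formula (R : realType) (a Q : R) : 0 < a -> Q != 0 ->
  let b := Q ^+ 2 + a ^+ 2 - 1 in
  let r := Num.sqrt (b ^+ 2 + 4 * Q ^+ 2) in
  let X := (b - 2 * Q ^+ 2 - r) ^+ 2 in
  let Y := a * (b - r) ^+ 2 in
  let Z := 4 * a * Q ^+ 2 in
  4 * (Y + Z) * (X + a * Z) / (X + Y + Z * (a + 1)) ^+ 2 =
  4 * a / ((1 + a) ^+ 2 + Q ^+ 2).
Proof.
move=> a0 Q0 b r X Y Z.
have Q2 : 0 < Q ^+ 2 by rewrite exprn_even_gt0.
have Z0 : 0 < Z by apply: mulr_gt0 => //; exact: mulr_gt0.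
have X0 : 0 <= X by exact: sqr_ge0.
have Y0 : 0 <= Y by rewrite mulr_ge0 ?sqr_ge0 // ltW.
have N0 : X + Y + Z * (a + 1) != 0.
  by rewrite lt0r_neq0 // ltr_wpDl ?addr_ge0 // mulr_gt0 // addr_gt0.
have d0 : (1 + a) ^+ 2 + Q ^+ 2 != 0 by rewrite lt0r_neq0 // ltr_wpDl ?sqr_ge0.
have r2 : r ^+ 2 = b ^+ 2 + 4 * Q ^+ 2.
  by rewrite sqr_sqrtr // addr_ge0 ?sqr_ge0 // mulr_ge0 // ltW.
apply/eqP; rewrite eqr_div ?expf_neq0 //; apply/eqP.
move: r2; rewrite /X /Y /Z /b; clearbody r => r2.
by ring: r2.
Qed.

Theorem theorem11 (R : realType) (H : completeNormedModType R[i])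
    (dot : {dot H for conjC}) (hdot : hilbert_norm dot)
    (A : @operator R H)
    (A_linear : linear_operator A) (A_dense : densely_defined A)
    (A_closed : closed_operator A) (A_symmetric : symmetric_operator dot A)
    (A_deficiency : deficiency_indices dot A 1 1)
    (gp gm : H)
    (gp_ker : ker_sub (adjoint dot A) 'i gp)
    (gm_ker : ker_sub (adjoint dot A) (- 'i) gm)
    (gp_normalized : norm_plus dot A gp = 1)
    (gm_normalized : norm_plus dot A gm = 1)
    (Th : Lsystem dot A)
    (T_non_selfadjoint : ~ op_eq (main Th) (adjoint dot (main Th)))
    (T_maximal : maximal_dissipative dot (main Th))
    (k : R) (k_bounds : 0 <= k < 1)
    (T_parameter : dom (main Th) (gp - k%:C *: gm))
    (quasi_kernel_parameter :
       dom (quasi_kernel dot A (re_pm (state Th))) (gp - gm))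
    (S : R) (S_entropy : c_entropy Th = S%:E)
    (Q : R) (Q_neq0 : Q != 0)
    (ThQ : Lsystem dot A) (ThQ_perturbed : perturbed Th Q ThQ) :
  let a := tanh (S / 2) in
  let b := Q ^+ 2 + a ^+ 2 - 1 in
  let r := Num.sqrt (b ^+ 2 + 4 * Q ^+ 2) in
  let X := (b - 2 * Q ^+ 2 - r) ^+ 2 in
  let Y := a * (b - r) ^+ 2 in
  let Z := 4 * a * Q ^+ 2 in
  forall D : R,
    dissipation_coefficient ThQ D <->
    D = 4 * (Y + Z) * (X + a * Z) / (X + Y + Z * (a + 1)) ^+ 2.
Proof.
move=> a b r X Y Z D.
have [k0 k1] := andP k_bounds.
(* Since [A^* g = z g] with [|z| = 1], the squared plus-norm is twice [(g, g)]. *)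
have normal g z : z * z^* = 1 -> ker_sub (adjoint dot A) z g -> norm_plus dot A g = 1 ->
    dot g g = 2^-1.
  move=> z1 [_ kg] /(congr1 (fun x => x ^+ 2)).
  rewrite /norm_plus /dot_plus kg dotZl dotZr mulrA z1 mul1r expr1n.
  have gg : (complex.Re (dot g g))%:C = dot g g.
    by rewrite -hdot RRe_real // realX // normr_real.
  rewrite -gg -rmorphD /= sqr_sqrtr; last first.
    by rewrite -ler0c rmorphD /= gg -hdot addr_ge0 // exprn_ge0.
  move=> e; have -> : complex.Re (dot g g) = 2^-1 by lra.
  by rewrite fmorphV rmorph_nat.
have gp_norm : dot gp gp = 2^-1.
  by apply: normal gp_ker gp_normalized; rewrite conjCi mulrN -expr2 sqrCi opprK.
have gm_norm : dot gm gm = 2^-1.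
  by apply: normal gm_ker gm_normalized; rewrite rmorphN /= conjCi opprK mulNr -expr2 sqrCi opprK.
have qk : forall g, Hplus dot A g ->
    re_pm (state Th) (gp - gm) g = dot (adjoint dot A (gp - gm)) g.
  exact: (quasi_kernelP hdot A_dense quasi_kernel_parameter).2.
have [impTh traTh] : impedance Th 'i = 'i * ((1 - k) / (1 + k))%:C /\
    transfer Th (- 'i) = k%:C.
  exact: (main_parameter_values hdot A_linear A_dense A_closed A_symmetric
    A_deficiency gp_ker gm_ker gp_norm gm_norm qk k_bounds T_parameter).
(* As [W(-i) = k], finite entropy excludes [k = 0]. *)
have k_neq0 : k != 0.
  by apply/eqP => k_eq0; move: S_entropy; rewrite /c_entropy traTh k_eq0 eqxx.
have k_gt0 : 0 < k by rewrite lt_neqAle eq_sym k_neq0.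
have aE : a = (1 - k) / (1 + k).
  move: S_entropy; rewrite /c_entropy traTh fmorph_eq0 (negPf k_neq0) => -[SE].
  by rewrite /a -SE /cabs ger0_norm ?ler0c // tanh_half_entropy.
have a_gt0 : 0 < a by rewrite aE divr_gt0 ?subr_gt0 // addr_gt0.
have impQ : impedance ThQ 'i = Q%:C + 'i * a%:C.
  by rewrite ThQ_perturbed ?impTh ?aE // -complexiE oner_neq0.
(* The quasi-kernel of [ThQ] need not contain [gp - gm], so [gm] is rotated for [ThQ]. *)
have [u [u1 qku]] := quasi_kernel_unimodular hdot A_linear A_dense A_closed
  A_symmetric A_deficiency gp_ker gm_ker gp_norm gm_norm ThQ.
have ugm_ker : ker_sub (adjoint dot A) (- 'i) (u *: gm).
  by apply: ker_subZ => //; exact: adjoint_linear.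
have ugm_norm : dot (u *: gm) (u *: gm) = 2^-1.
  by rewrite dotZl dotZr mulrA u1 mul1r.
rewrite dissipation_formula //.
exact: (dissipation_perturbed hdot A_linear A_dense A_closed A_symmetric
  A_deficiency gp_ker ugm_ker gp_norm ugm_norm qku a_gt0 impQ).
Qed.
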